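(* Let $A,B,d$ be given. There exist constants $C=C(A,B,d)$ and $D=D(A,B,d)$ such that for every field $\mathbb F$, every $n$ and every $s>0$: if $\mathcal Q$ is a collection of $m$ homogeneous polynomials in $\mathbb F[x_1,\dots,x_n]$ of positive degrees $\le d$, then there exists a polynomial tower $\mathcal Q'$ in $\mathbb F[x_1,\dots,x_n]$ of dimension $\le C(m+s)^D$, degree $\le d$ and height $\le d$ such that $\mathcal Q'$ is $(A,B,s)$-regular and $\mathcal Q\subset I(\mathcal Q')$, where $I(\mathcal Q')$ is the ideal generated by the polynomials in $\mathcal Q'$.
   Context: For a polynomial $P$ of degree $e$, $\tilde P$ is its homogeneous component of degree $e$ ($\tilde 0=0$); for a collection, $\tilde{\mathcal Q}=(\tilde Q_i)_i$. Schmidt rank: for a homogeneous polynomial $P$, $rk(P)$ is the minimal $r$ such that $P=\sum_{i=1}^r Q_iR_i$ with all $Q_i,R_i$ homogeneous of degree $<\deg(P)$ ($rk(0)=0$; $rk(P)=\infty$ if there is no such presentation, e.g. for a nonzero linear form). Convention: constants have rank $0$. For general $P$, $rk(P)=rk(\tilde P)$. Relative rank: for homogeneous $P$ and a collection $\mathcal Q=(Q_1,\dots,Q_m)$ of homogeneous polynomials, $$rk_{\mathcal Q}(P)=\min\Big\{rk\Big(P+\sum_{i=1}^m R_iQ_i\Big): \deg(R_i)+\deg(Q_i)\le\deg(P)\ \forall i\Big\}$$ over polynomials $R_i$ (so $R_i=0$ whenever $\deg(Q_i)>\deg(P)$). For general polynomials, $rk_{\mathcal Q}(P):=rk_{\tilde{\mathcal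 Q}}(\tilde P)$. For a collection $\mathcal P=(P_i)_{i\in[m]}$, $rk_{\mathcal Q}(\mathcal P)=\min\{rk_{\mathcal Q}(a\cdot\tilde{\mathcal P}): 0\ne a\in\mathbb F^m\}$, where $a\cdot\tilde{\mathcal P}=\sum_i a_i\tilde P_i$. A (polynomial) tower $\mathcal Q=(\mathcal Q_i)_{i\in[h]}$ of height $h$ consists of $h$ collections (layers) $\mathcal Q_i=(Q_{i,j})_{j\in[m_i]}$ of polynomials, where all polynomials in the $i$-th layer have the same degree $d_i$. Its degree is $\max(d_1,\dots,d_h)$, its dimension is $m_1+\dots+m_h$, and $\mathcal Q_{<i}=(\mathcal Q_j)_{j\in[i-1]}$ (regarded as a collection of polynomials when taking relative rank). The tower is $(A,B,s)$-regular if for every $i\in[h]$, $rk_{\mathcal Q_{<i}}(\mathcal Q_i)>A(m_i+m_{i+1}+\dots+m_h+s)^B$. *)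

(* Defs.v *)
From HB Require Import structures.
From mathcomp Require Import all_boot all_order all_algebra.
From mathcomp Require Import boolp classical_sets reals constructive_ereal ereal exp.
(* The notations of mpoly.v clash with those of MathComp-Analysis, so they are
   left out and the few that are needed are redeclared below. *)
From mathcomp Require Import -(notations) mpoly.

Set Implicit Arguments.
Unset Strict Implicit.
Unset Printing Implicit Defensive.

Import Order.TTheory GRing.Theory Num.Theory.

Local Open Scope classical_set_scope.
Local Open Scope ring_scope.

Notation "{ 'mpoly' T [ n ] }" := (mpoly n T)
  (at level 0, T, n at level 2, format "{ 'mpoly'  T [ n ] }") : type_scope.

Section PolynomialRank.
Context {F : fieldType} {n : nat}.
Implicit Types (P : {mpoly F[n]}) (Q : seq {mpoly F[n]}).

(* [msize P] is 1 + the total degree of P, and 0 for P = 0.  Hence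
   [mdegree 0 = 0]: where the degree of the zero polynomial matters, it is
   treated separately. *)
Definition msize P : nat := mmeasure mdeg P.
Definition mdegree P : nat := (msize P).-1.

(* As in mpoly.v, 0 is homogeneous of every degree. *)
Definition homogeneous (e : nat) P : bool := P \in ishomog1 e mdeg.

Definition top_part P : {mpoly F[n]} := pihomog mdeg (mdegree P) P.

Definition Schmidt_presentation P (r : nat) : Prop :=
  exists S T : 'I_r -> {mpoly F[n]},
    [/\ forall k, exists2 e, (e < mdegree P)%N & homogeneous e (S k),
        forall k, exists2 e, (e < mdegree P)%N & homogeneous e (T k)
      & P = \sum_(k < r) S k * T k].

Definition in_ideal Q P : Prop :=
  exists c : 'I_(size Q) -> {mpoly F[n]}, P = \sum_(k < size Q) c k * Q`_k.

(* Ranks take values in {0, 1, 2, ...} with +oo added.  On sets of such values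
   the infimum in [\bar R] is a minimum, and it is +oo on the empty set. *)
Context (R : realType).

Definition homog_rank P : \bar R :=
  if (msize P <= 1)%N then 0%E
  else ereal_inf [set (r%:R)%:E | r in Schmidt_presentation P].

Definition Schmidt_rank P : \bar R := homog_rank (top_part P).

Definition homog_relative_rank Q P : \bar R :=
  ereal_inf [set Schmidt_rank (P + \sum_(k < size Q) T k * Q`_k) |
    T in [set T : 'I_(size Q) -> {mpoly F[n]} |
      forall k, T k != 0 -> (mdegree (T k) + mdegree (Q`_k)%R <= mdegree P)%N]].

Definition relative_rank Q P : \bar R :=
  homog_relative_rank (map top_part Q) (top_part P).

Definition relative_rank_coll Q (Ps : seq {mpoly F[n]}) : \bar R :=
  ereal_inf [set relative_rank Q (\sum_(k < size Ps) a 0 k *: top_part Ps`_k) |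
    a in [set a : 'rV[F]_(size Ps) | a != 0]].

End PolynomialRank.

Arguments homog_rank {F n} R P.
Arguments Schmidt_rank {F n} R P.
Arguments homog_relative_rank {F n} R Q P.
Arguments relative_rank {F n} R Q P.
Arguments relative_rank_coll {F n} R Q Ps.

(* Layers may be empty, in which case the degree is still part of the data. *)
Record tower (F : fieldType) (n : nat) := Tower {
  height : nat;
  layer_degree : 'I_height -> nat;
  layer : 'I_height -> seq {mpoly F[n]};
  layer_degreeP : forall i P, P \in layer i ->
    P != 0 /\ mdegree P = layer_degree i
}.

Section Towers.
Context {F : fieldType} {n : nat}.
Implicit Type Q : tower F n.

Definition tower_degree Q : nat := (\max_(i < height Q) layer_degree i)%N.

Definition tower_dim Q : nat := (\sum_(i < height Q) size (layer i))%N.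

Definition tower_below Q (i : 'I_(height Q)) : seq {mpoly F[n]} :=
  flatten [seq layer j | j : 'I_(height Q) <- enum 'I_(height Q) & (j < i)%N].

Definition tower_polys Q : seq {mpoly F[n]} :=
  flatten [seq layer j | j <- enum 'I_(height Q)].

Definition regular {R : realType} (A B s : R) Q : Prop :=
  forall i : 'I_(height Q),
    ((A * ((\sum_(j < height Q | i <= j) size (layer j))%N%:R + s) `^ B)%:E
      < relative_rank_coll R (tower_below i) (layer i))%E.

End Towers.

(* Main.v *)
(* Group the polynomials by degree, layer i holding those of degree i+1.  If
   layer i is not regular, then a nontrivial combination \sum_k a_k P_k of it is
   congruent, modulo the layers below, to a sum of at most r_i products S T of
   forms of smaller degree.  Delete some P_k with a_k <> 0 and put the factors S
   into the layers below.  The threshold r_i depends only on the sizes of the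
   layers from i upwards, so there are weights w_i, of ratio polynomial in m + s,
   with w_j (r_i + 1) <= w_i for j < i.  Each move then lowers the sum of the
   w_i m_i, so the process stops, and its initial value bounds all sizes. *)
Require Import Defs.
From mathcomp Require Import all_boot all_order all_algebra.
From mathcomp Require Import boolp classical_sets reals constructive_ereal ereal exp.
From mathcomp Require Import -(notations) mpoly.
Set Implicit Arguments.
Unset Strict Implicit.
Unset Printing Implicit Defensive.

Import Order.TTheory GRing.Theory Num.Theory.
Local Open Scope ring_scope.

(** * Membership in a finitely generated ideal *)

Section Ideals.
Variables (F : fieldType) (n : nat).
Implicit Types (P : {mpoly F[n]}) (Q : seq {mpoly F[n]}).

Lemma in_ideal0 Q : in_ideal Q 0.
Proof. by exists (fun _ => 0); rewrite big1 // => k _; rewrite mul0r. Qed.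

Lemma in_idealD Q P1 P2 : in_ideal Q P1 -> in_ideal Q P2 -> in_ideal Q (P1 + P2).
Proof.
move=> [c1 ->] [c2 ->]; exists (fun k => c1 k + c2 k); rewrite -big_split /=.
by apply: eq_bigr => k _; rewrite mulrDl.
Qed.

Lemma in_idealMl Q c P : in_ideal Q P -> in_ideal Q (c * P).
Proof.
move=> [c1 ->]; exists (fun k => c * c1 k); rewrite mulr_sumr.
by apply: eq_bigr => k _; rewrite mulrA.
Qed.

Lemma in_ideal_sum Q (I : Type) (r : seq I) (p : pred I) (f : I -> {mpoly F[n]}) :
  (forall i, p i -> in_ideal Q (f i)) -> in_ideal Q (\sum_(i <- r | p i) f i).
Proof. by move=> h; elim/big_ind: _ => //; [exact: in_ideal0 | exact: in_idealD]. Qed.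

Lemma mem_in_ideal Q P : P \in Q -> in_ideal Q P.
Proof.
move=> PQ; have hk : (index P Q < size Q)%N by rewrite index_mem.
exists (fun k => (k == Ordinal hk)%:R).
rewrite (bigD1 (Ordinal hk)) //= eqxx mul1r nth_index // big1 ?addr0 // => k /negPf ->.
by rewrite mul0r.
Qed.

Lemma in_ideal_trans Q Q' P :
  (forall X, X \in Q -> in_ideal Q' X) -> in_ideal Q P -> in_ideal Q' P.
Proof.
move=> h [c ->]; apply: in_ideal_sum => k _; apply: in_idealMl; apply: h.
exact: mem_nth.
Qed.

Lemma in_ideal_subset Q Q' P : {subset Q <= Q'} -> in_ideal Q P -> in_ideal Q' P.
Proof. by move=> h; apply: in_ideal_trans => X /h; apply: mem_in_ideal. Qed.

Lemma in_idealZ Q (a : F) P : in_ideal Q P -> in_ideal Q (a *: P).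
Proof. by rewrite -mul_mpolyC; exact: in_idealMl. Qed.

End Ideals.

(** * Homogeneous components, and ideal membership from small rank *)

Section Homogeneous.
Variables (F : fieldType) (n : nat).
Implicit Types (P S T : {mpoly F[n]}) (Q : seq {mpoly F[n]}).

Lemma mdegree_homogeneous e P : P != 0 -> homogeneous e P -> mdegree P = e.
Proof.
by move=> P0 he; apply: (dhomog_uniq P0 _ he); apply: dhomog_msize he.
Qed.

Lemma top_part_homogeneous e P : homogeneous e P -> top_part P = P.
Proof.
have [-> _|P0 he] := eqVneq P 0; first by rewrite /top_part pihomog0.
by apply: pihomog_dE; rewrite (mdegree_homogeneous P0 he).
Qed.

Lemma pihomogM_homogeneous e e1 e2 S T : homogeneous e1 S -> homogeneous e2 T ->
  pihomog mdeg e (S * T) = if (e1 + e2 == e)%N then S * T else 0.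
Proof.
move=> hS hT; have hST := dhomogM hS hT; case: eqVneq => [<-|ne].
  exact: pihomog_dE.
exact: pihomog_ne0 ne hST.
Qed.

Lemma top_part_pihomog e P : (mdegree P <= e)%N -> pihomog mdeg e P != 0 ->
  top_part P = pihomog mdeg e P.
Proof.
move=> le_e; rewrite /top_part; have [->//|ne] := eqVneq (mdegree P) e.
suff -> : pihomog mdeg e P = 0 by rewrite eqxx.
rewrite pihomogE big_seq_cond big1 // => m /andP[/mmeasure_mnm_lt lt_m /eqP em].
have {}lt_m := lt_m mdeg; move: ne; rewrite eqn_leq le_e /= -em /mdegree => /negP[].
by rewrite -ltnS (leq_trans lt_m) // leqSpred.
Qed.

(** Expand [T] into homogeneous components: only the one of degree [e - e'] contributes, and it
    contributes a multiple of [S]. *)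
Lemma pihomogM_ideal e e' T S : homogeneous e' S ->
  exists c, pihomog mdeg e (T * S) = c * S.
Proof.
move=> hS; have TE := @pihomog_partitionE n F mdeg _ T (leqnn _).
exists (\sum_(k < mmeasure mdeg T | (k + e' == e)%N) pihomog mdeg k T).
rewrite {1}TE !mulr_suml raddf_sum [RHS]big_mkcond /=; apply: eq_bigr => k _.
exact: pihomogM_homogeneous (pihomogP _ _ _) hS.
Qed.

Lemma mdegreeD_le e P S : (mdegree P <= e -> mdegree S <= e ->
  mdegree (P + S)%R <= e)%N.
Proof.
rewrite /mdegree /Defs.msize -!subn1 !leq_subLR => hP hS.
by apply: leq_trans (mmeasureD_le _ _ _) _; rewrite geq_max hP.
Qed.

Lemma mdegree0 : mdegree (0 : {mpoly F[n]}) = 0%N.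
Proof. by rewrite /mdegree /Defs.msize mmeasure0. Qed.

Lemma mdegreeM_le S T : (mdegree (S * T)%R <= mdegree S + mdegree T)%N.
Proof.
have [->|S0] := eqVneq S 0; first by rewrite mul0r mdegree0.
have [->|T0] := eqVneq T 0; first by rewrite mulr0 mdegree0.
by rewrite /mdegree /Defs.msize msizeM // (mpolySpred _ S0) (mpolySpred _ T0) /= addnS.
Qed.

(* Only the terms S_k T_k of degree exactly e matter; since both factors have
   degree < e, such an S_k has positive degree. *)
Lemma Schmidt_presentation_ideal e P r : P != 0 -> homogeneous e P ->
  Schmidt_presentation P r ->
  exists s : seq {mpoly F[n]}, [/\ (size s <= r)%N,
    forall S, S \in s -> S != 0 /\ exists2 e', (0 < e' < e)%N & homogeneous e' S
    & in_ideal s P].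
Proof.
move=> P0 hP [S [T [hS hT PE]]].
move: hS hT; rewrite (mdegree_homogeneous P0 hP) => hS hT.
exists [seq S k | k <- enum 'I_r & pihomog mdeg e (S k * T k) != 0]; split.
- by rewrite size_map size_filter (leq_trans (count_size _ _)) ?size_enum_ord.
- move=> U /mapP[k]; rewrite mem_filter => /andP[ST0 _] ->.
  have [e1 lt1 h1] := hS k; have [e2 lt2 h2] := hT k.
  move: ST0; rewrite (pihomogM_homogeneous _ h1 h2).
  case: (eqVneq (e1 + e2)%N e) => [e12|_]; last by rewrite eqxx.
  rewrite mulf_eq0 => /norP[S0 _]; split=> //; exists e1 => //.
  by rewrite lt1 andbT lt0n; apply: contraTneq lt2 => e10; rewrite -e12 e10 ltnn.
- rewrite -(pihomog_dE hP) PE raddf_sum; apply: in_ideal_sum => k _ /=.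
  have [->|ST0] := eqVneq (pihomog mdeg e (S k * T k)) 0; first exact: in_ideal0.
  have [e1 lt1 h1] := hS k; have [e2 lt2 h2] := hT k.
  rewrite mulrC; have [c ->] := pihomogM_ideal e (T k) h1.
  by apply/in_idealMl/mem_in_ideal/map_f; rewrite mem_filter ST0 mem_enum.
Qed.

(** The multipliers in the relative rank need not be homogeneous, so everything is projected to
    degree [e]. This fixes [P] and turns a multiple of a form in [Q] into another multiple of it. *)
Lemma relative_rank_ideal (R : realType) e P Q r : (0 < e)%N -> homogeneous e P ->
  (forall S, S \in Q -> exists e', homogeneous e' S) ->
  (relative_rank R Q P < r.+1%:R%:E)%E ->
  exists s : seq {mpoly F[n]}, [/\ (size s <= r)%N,
    forall S, S \in s -> S != 0 /\ exists2 e', (0 < e' < e)%N & homogeneous e' S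
    & in_ideal (Q ++ s) P].
Proof.
move=> e0 hP hQ; have [-> _|P0] := eqVneq P 0.
  by exists [::]; split=> //; exact: in_ideal0.
rewrite /relative_rank (top_part_homogeneous hP) map_id_in; last first.
  by move=> S /hQ[e']; apply: top_part_homogeneous.
move=> /ereal_inf_lt[_ [T hT <-]]; rewrite /= (mdegree_homogeneous P0 hP) in hT.
set P' := P + _; rewrite /Schmidt_rank.
have dP' : (mdegree P' <= e)%N.
  rewrite mdegreeD_le ?(mdegree_homogeneous P0 hP) //.
  elim/big_ind: _ => [|? ?|k _]; [by rewrite mdegree0 | exact: mdegreeD_le |].
  have [->|T0] := eqVneq (T k) 0; first by rewrite mul0r mdegree0.
  by apply: leq_trans (mdegreeM_le _ _) (hT _ T0).
have PE : P = pihomog mdeg e P' - \sum_(k < size Q) pihomog mdeg e (T k * Q`_k).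
  by rewrite raddfD raddf_sum /= (pihomog_dE hP) addrK.
have inQ s : in_ideal s (pihomog mdeg e P') -> in_ideal (Q ++ s) P.
  move=> hs; rewrite PE; apply: in_idealD.
    by apply: in_ideal_subset hs => X; rewrite mem_cat orbC => ->.
  rewrite -mulN1r; apply/in_idealMl/in_ideal_sum => k _.
  have Qk : Q`_k \in Q by rewrite mem_nth.
  have [e' he'] := hQ _ Qk; have [c ->] := pihomogM_ideal e (T k) he'.
  by apply/in_idealMl/mem_in_ideal; rewrite mem_cat Qk.
(* If the degree-[e] part cancels, [P] already lies in the ideal of [Q] and [s] is empty. Otherwise
   it is the top part of [P'], whose Schmidt rank is bounded. *)
have [X0 _|X0] := eqVneq (pihomog mdeg e P') 0.
  by exists [::]; split=> //; apply: inQ; rewrite X0; exact: in_ideal0.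
have hX : homogeneous e (pihomog mdeg e P') by exact: pihomogP.
rewrite (top_part_pihomog dP' X0) /homog_rank.
have := mdegree_homogeneous X0 hX; rewrite /mdegree => dX.
(* Positive degree excludes the branch of [homog_rank] for constants. *)
have -> : (Defs.msize (pihomog mdeg e P') <= 1)%N = false.
  by apply/negbTE; rewrite -ltnNge -(ltn_predRL) ?dX.
move=> /ereal_inf_lt[_ [r' pr <-]]; rewrite lte_fin ltr_nat ltnS => r'r.
have [s [ss hs Xs]] := Schmidt_presentation_ideal X0 hX pr.
by exists s; split=> //; [exact: leq_trans ss r'r | exact: inQ].
Qed.
End Homogeneous.

(** * Layers graded by degree, and the regularization process *)

Section Layers.
Variables (F : fieldType) (n d : nat).
Implicit Types (P : {mpoly F[n]}) (L : 'I_d -> seq {mpoly F[n]}).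

Definition graded L :=
  forall (i : 'I_d) P, P \in L i -> P != 0 /\ homogeneous i.+1 P.

Definition all_layers L := flatten [seq L j | j <- enum 'I_d].

(** Written as [tower_below] is, so that statements about [L] convert to statements about the tower
    built from it. *)
Definition layers_below L (i : 'I_d) :=
  flatten [seq L j | j : 'I_d <- enum 'I_d & (j < i)%N].

Lemma all_layersP L P : reflect (exists j, P \in L j) (P \in all_layers L).
Proof.
apply: (iffP flatten_mapP) => [[j _ Pj]|[j Pj]]; first by exists j.
by exists j; rewrite ?mem_enum.
Qed.

Lemma layers_belowP L (i : 'I_d) P :
  reflect (exists2 j : 'I_d, (j < i)%N & P \in L j) (P \in layers_below L i).
Proof.
apply: (iffP flatten_mapP) => [[j]|[j ji Pj]].
  by rewrite mem_filter => /andP[ji _] Pj; exists j.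
by exists j; rewrite // mem_filter ji mem_enum.
Qed.

Definition homogeneous_part (s : seq {mpoly F[n]}) (i : 'I_d) :=
  [seq P <- s | (P != 0) && homogeneous i.+1 P].

(** A nonzero polynomial is homogeneous of at most one degree, so no entry of [s] is counted
    twice. *)
Lemma sum_size_homogeneous_part s :
  (\sum_(i < d) size (homogeneous_part s i) <= size s)%N.
Proof.
elim: s => [|P s IHs]; first by rewrite big1.
pose p (i : 'I_d) := (P != 0) && homogeneous i.+1 P.
have -> : (\sum_(i < d) size (homogeneous_part (P :: s) i) =
    \sum_(i < d) p i + \sum_(i < d) size (homogeneous_part s i))%N.
  rewrite -big_split; apply: eq_bigr => i _.
  by rewrite /homogeneous_part /= -/(p i); case: (p i).
apply: (leq_add (n1 := 1)) => //; have [i pi|p0] := pickP p; last first.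
  by rewrite big1 // => i _; rewrite p0.
rewrite (bigD1 i) //= pi big1 // => j ji; apply/eqP; rewrite eqb0.
apply: contra ji => /andP[_ hj]; case/andP: pi => P0 hi.
by apply/eqP/val_inj/succn_inj; exact: dhomog_uniq P0 hj hi.
Qed.

(** A single move, with [c j] counting the factors added to layer [j]. The deleted polynomial is
    recovered from the low-rank combination and the rest of its layer, its coefficient being
    invertible. *)
Lemma reduce_layer (R : realType) L (i : 'I_d) r : graded L ->
  (relative_rank_coll R (layers_below L i) (L i) < r.+1%:R%:E)%E ->
  exists L' (c : 'I_d -> nat), [/\ graded L',
    (size (L' i) < size (L i))%N,
    forall j : 'I_d, (i < j)%N -> L' j = L j,
    forall j : 'I_d, (j < i)%N -> size (L' j) = (size (L j) + c j)%N
    & (\sum_(j < d | (j < i)%N) c j <= r)%N] /\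
    forall P, in_ideal (all_layers L) P -> in_ideal (all_layers L') P.
Proof.
move=> gL /ereal_inf_lt[_ [a /rV0Pn[k ak] <-]].
have topE l : top_part (L i)`_l = (L i)`_l :> {mpoly F[n]}.
  have [lt_l|ge_l] := ltnP l (size (L i)); last first.
    by rewrite nth_default // /top_part pihomog0.
  by have [_] := gL i _ (mem_nth 0 lt_l); apply: top_part_homogeneous.
under eq_bigr do rewrite topE.
set P := \sum_(_ < _) _ => rkP.
have hP : homogeneous i.+1 P.
  apply: rpred_sum => l _; apply: dhomogZ.
  by have [] := gL i _ (mem_nth 0 (ltn_ord l)).
have [//|S /layers_belowP[j _ /gL[_ hS]]|s [ss hs Ps]] := relative_rank_ideal _ hP _ rkP.
  by exists j.+1.
(* Deletion is by position, as a layer may list a polynomial twice. *)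
pose rest := take k (L i) ++ drop k.+1 (L i).
have restP (l : 'I_(size (L i))) : l != k -> (L i)`_l \in rest.
  rewrite -val_eqE mem_cat /=; case: ltngtP => // [lk|kl] _; apply/orP; [left|right].
    by rewrite -(nth_take 0 lk) mem_nth // size_take ltn_ord.
  have kl' : (k.+1 <= l)%N := kl.
  rewrite -(subnKC kl') -nth_drop mem_nth // size_drop ltn_sub2r //.
  exact: leq_ltn_trans kl (ltn_ord l).
have rest_sub X : X \in rest -> X \in L i.
  by rewrite mem_cat => /orP[/mem_take|/mem_drop].
(* Every form in [s] has degree between 1 and [i], hence falls into a layer below [i]. *)
pose L' (j : 'I_d) := if (j < i)%N then L j ++ homogeneous_part s j
  else if (i < j)%N then L j else rest.
have L'i : L' i = rest by rewrite /L' ltnn.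
exists L', (fun j => size (homogeneous_part s j)); split; [split|].
- move=> j X; rewrite /L'; case: ltngtP => [ji|ij|/val_inj->].
  + rewrite mem_cat => /orP[/gL//|].
    by rewrite mem_filter => /andP[/andP[]].
  + exact: gL.
  + by move/rest_sub/gL.
- rewrite L'i size_cat size_take ltn_ord size_drop -addSn subnKC //.
- by move=> j ij; rewrite /L' ltnNge (ltnW ij) ij.
- by move=> j ji; rewrite /L' ji size_cat.
- apply: leq_trans ss; apply: leq_trans (sum_size_homogeneous_part s).
  by rewrite [leqRHS](bigID (fun j : 'I_d => (j < i)%N)) leq_addr.
- move=> X; apply: in_ideal_trans => {}X /all_layersP[j].
  have sub Y : Y \in rest -> in_ideal (all_layers L') Y.
    by move=> Yr; apply/mem_in_ideal/all_layersP; exists i; rewrite L'i.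
  have PL' : in_ideal (all_layers L') P.
    apply: in_ideal_trans Ps => Y; rewrite mem_cat => Ys.
    apply/mem_in_ideal/all_layersP; case/orP: Ys => [/layers_belowP[l li Yl]|Ys].
      by exists l; rewrite /L' li mem_cat Yl.
    have [Y0 [e' /andP[e0 ei] he]] := hs _ Ys.
    have e'd : (e'.-1 < i)%N by rewrite -ltnS prednK.
    exists (Ordinal (ltn_trans e'd (ltn_ord i))).
    by rewrite /L' /= e'd mem_cat mem_filter Y0 /= prednK // he Ys orbT.
  have [ji|ij|/val_inj->] := ltngtP j i => Xj.
  + by apply/mem_in_ideal/all_layersP; exists j; rewrite /L' ji mem_cat Xj.
  + by apply/mem_in_ideal/all_layersP; exists j; rewrite /L' ltnNge (ltnW ij) ij.
  have [l lt_l <-] := nthP 0 Xj.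
  have [lk|/restP/sub//] := eqVneq (Ordinal lt_l) k.
  rewrite -[l]/(nat_of_ord (Ordinal lt_l)) lk.
  have -> : (L i)`_k = (a 0 k)^-1 *: (P - \sum_(l < _ | l != k) a 0 l *: (L i)`_l).
    by rewrite /P (bigD1 k) //= addrK scalerA mulVf // scale1r.
  apply/in_idealZ/in_idealD => //; rewrite -mulN1r; apply/in_idealMl/in_ideal_sum => l' l'k.
  exact/in_idealZ/sub/restP.
Qed.

(** Induction on the weighted size, which each move strictly lowers. It never exceeds [M], so the
    threshold inequality is only required at sizes [x] compatible with [M]. *)
Lemma regularize_layers (R : realType) (A B s : R) (w r : 'I_d -> nat) M L :
  (forall i, 0 < w i)%N ->
  (forall i j : 'I_d, j < i -> w j * (r i).+1 <= w i)%N ->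
  (forall i x, (0 < x)%N -> (w i * x <= M)%N ->
     A * (x%:R + s) `^ B < (r i).+1%:R) ->
  graded L -> (\sum_(i < d) w i * size (L i) <= M)%N ->
  exists L', [/\ graded L', (\sum_(i < d) w i * size (L' i) <= M)%N,
    forall i : 'I_d, ((A * ((\sum_(j < d | i <= j) size (L' j))%N%:R + s) `^ B)%:E
      < relative_rank_coll R (layers_below L' i) (L' i))%E
    & forall P, in_ideal (all_layers L) P -> in_ideal (all_layers L') P].
Proof.
move=> w0 ww wA; have [N] := ubnP (\sum_(i < d) w i * size (L i))%N.
elim: N L => // N IHN L ltN gL leM.
have [reg|/existsNP[i /negP]] := pselect (forall i : 'I_d,
  ((A * ((\sum_(j < d | i <= j) size (L j))%N%:R + s) `^ B)%:E
      < relative_rank_coll R (layers_below L i) (L i))%E); first by exists L.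
rewrite -leNgt => rk_le.
(* An empty layer has no nonzero coefficient vector, so its rank is [+oo]; a layer that fails is
   therefore nonempty. *)
have Li0 : (0 < size (L i))%N.
  rewrite lt0n; apply: contraTneq rk_le => Li0; rewrite -ltNge.
  rewrite /relative_rank_coll (_ : mkset _ = set0) ?image_set0 ?ereal_inf0 ?ltry //.
  apply/seteqP; split=> // a /= /rV0Pn[k]; have := ltn_ord k.
  by rewrite {2}Li0.
set x := (\sum_(j < d | _) _)%N in rk_le.
have x0 : (0 < x)%N by rewrite /x (bigD1 i) //= ltn_addr.
(* Weights are nondecreasing in the layer index, so [w i * x] is at most the weighted size of the
   layers from [i] upwards. *)
have wx : (w i * x <= M)%N.
  apply: leq_trans leM; rewrite big_distrr /= [leqRHS](bigID (fun j : 'I_d => (i <= j)%N)) /=.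
  apply: leq_trans (leq_addr _ _); apply: leq_sum => j ij; rewrite leq_mul2r; apply/orP; right.
  move: ij; rewrite leq_eqVlt => /orP[/eqP/val_inj-> //|ij].
  by apply: leq_trans (ww _ _ ij); rewrite leq_pmulr.
have /(reduce_layer gL)[L' [c [[gL' szi szgt szlt sumc] idL']]] :
    (relative_rank_coll R (layers_below L i) (L i) < (r i).+1%:R%:E)%E.
  by apply: le_lt_trans rk_le _; rewrite lte_fin wA.
suff drop : (\sum_(j < d) w j * size (L' j) < \sum_(j < d) w j * size (L j))%N.
  have [||L2 [gL2 M2 reg2 id2]] := IHN L' _ gL'.
  - exact: leq_trans drop _.
  - exact: leq_trans (ltnW drop) leM.
  by exists L2; split=> // P /idL'/id2.
(* There are at most [r i] new forms, each of weight at most [w i / (r i).+1]; multiplying by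
   [(r i).+1] avoids the division. *)
have wc : (\sum_(j < d | (j < i)%N) w j * c j < w i)%N.
  rewrite -(ltn_pmul2r (ltn0Sn (r i))) big_distrl /=.
  apply: (@leq_ltn_trans (w i * r i)); last by rewrite ltn_pmul2l.
  apply: (@leq_trans (\sum_(j < d | (j < i)%N) w i * c j)).
    by apply: leq_sum => j ji; rewrite mulnAC leq_mul2r ww ?orbT.
  by rewrite -big_distrr leq_mul2l sumc orbT.
have split f : (\sum_(j < d) w j * f j = w i * f i +
    (\sum_(j < d | (j < i)%N) w j * f j + \sum_(j < d | (i < j)%N) w j * f j))%N.
  rewrite (bigD1 i) //= (bigID (fun j : 'I_d => (j < i)%N)) /=; congr (_ + (_ + _))%N.
    by apply: eq_bigl => j; rewrite andb_idl // => ji; rewrite -val_eqE ltn_eqF.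
  by apply: eq_bigl => j; rewrite -val_eqE /=; case: ltngtP.
rewrite !split (eq_bigr (fun j => w j * size (L j) + w j * c j)%N); last first.
  by move=> j ji; rewrite szlt // mulnDr.
rewrite big_split /= [X in (_ + (_ + X) < _)%N](eq_bigr (fun j => w j * size (L j))%N); last first.
  by move=> j ij; rewrite szgt.
(* The deletion frees at least [w i], which by [wc] exceeds the weight of the added forms. *)
have szw : (w i * size (L' i) + w i <= w i * size (L i))%N by rewrite -mulnSr leq_mul2l szi orbT.
rewrite [X in (_ + X < _)%N]addnAC addnCA [ltnRHS]addnC ltn_add2l.
by apply: leq_trans szw; rewrite ltn_add2l.
Qed.
End Layers.

(** * Polynomial growth of the weights, and integer bounds on the threshold *)

Section Growth.
Variables a b : nat.

(* [growth N t] is the ratio of the top weight to the weight of the layer t steps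
   below the top. *)
Fixpoint growth N t := if t is t'.+1 then
  (growth N t' * (a * (N * growth N t') ^ b).+1)%N else 1%N.

Lemma growth_gt0 N t : (0 < growth N t)%N.
Proof. by elim: t => //= t IHt; rewrite muln_gt0 IHt. Qed.

Lemma dvdn_growth N t u : (t <= u)%N -> (growth N t %| growth N u)%N.
Proof.
move=> /subnKC <-; elim: (u - t)%N => [|v IHv]; first by rewrite addn0.
by rewrite addnS /= dvdn_mulr.
Qed.

(** Given the bound [C * N ^ D] at [t], the next factor is at most
    [(a * C ^ b).+1 * N ^ (D.+1 * b)]; the successor is absorbed because [N] is positive. *)
Lemma growth_poly t :
  exists C D, forall N, (0 < N)%N -> (growth N t <= C * N ^ D)%N.
Proof.
elim: t => [|t [C [D IHt]]]; first by exists 1%N, 0%N.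
exists (C * (a * C ^ b).+1)%N, (D + D.+1 * b)%N => N N0 /=.
rewrite expnD mulnACA leq_mul ?IHt // expnM mulSn -add1n leq_add //.
  by rewrite !expn_gt0 N0.
rewrite -mulnA leq_mul2l -expnMn; apply/orP; right.
have [->//|b0] := posnP b.
by rewrite leq_exp2r // expnS mulnCA leq_mul2l IHt ?orbT.
Qed.
End Growth.

(** Powers are nonnegative, so a negative [A] is covered too; [1 <= x] gives monotonicity in the
    exponent. *)
Lemma scaled_powR_le (R : realType) (A B x : R) (a b X : nat) :
  A <= a%:R -> B <= b%:R -> 1 <= x -> x <= X%:R -> A * x `^ B <= (a * X ^ b)%N%:R.
Proof.
move=> Aa Bb x1 xX; apply: (@le_trans _ _ (a%:R * x `^ B)).
  by rewrite ler_wpM2r // powR_ge0.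
rewrite natrM natrX ler_wpM2l //.
apply: le_trans (ler_powR x1 Bb) _; rewrite powR_mulrn ?(le_trans ler01 x1) //.
by apply: lerXn2r; rewrite ?nnegrE ?ler0n ?(le_trans ler01 x1).
Qed.

(** * Choice of the constants and construction of the tower *)

Theorem theorem2p3 (R : realType) (A B : R) (d : nat) :
  exists C D : R,
    forall (F : fieldType) (n : nat) (s : R) (m : nat)
      (Q : m.-tuple {mpoly F[n]}),
      0 < s ->
      (forall P, P \in Q ->
         exists e : nat, (0 < e <= d)%N /\ homogeneous e P) ->
      exists Q' : tower F n,
        [/\ (tower_dim Q')%:R <= C * (m%:R + s) `^ D,
            (tower_degree Q' <= d)%N,
            (height Q' <= d)%N,
            regular A B s Q'
          & forall P, P \in Q -> in_ideal (tower_polys Q') P].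
Proof.
pose a := (Num.trunc A).+1; pose b := (Num.trunc B).+1.
have Aa : A <= a%:R by exact/ltW/truncnS_gt.
have Bb : B <= b%:R by exact/ltW/truncnS_gt.
have [C [D growth_le]] := growth_poly a b d.-1.
(* With [N] and [k] as below, the dimension is at most [m * k d.-1 <= N * (C * N ^ D)], and
   [N <= 2 * (m + s)] when [m] is positive. *)
exists (C * 2 ^ D.+1)%N%:R, D.+1%:R => F n s m Q s0 hQ.
pose N := (Num.trunc (m%:R + s)).+1.
have msN : m%:R + s <= N%:R by exact/ltW/truncnS_gt.
pose k := growth a b N.
pose t (i : 'I_d) := (d.-1 - i)%N.
(* The division is exact, by [dvdn_growth]; [t i] is the distance of layer [i] from the top. *)
pose w i := (k d.-1 %/ k (t i))%N; pose r i := (a * (N * k (t i)) ^ b)%N.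
have k0 u : (0 < k u)%N by exact: growth_gt0.
have wk i : (w i * k (t i) = k d.-1)%N by rewrite divnK // dvdn_growth // leq_subr.
have w0 i : (0 < w i)%N by rewrite -(ltn_pmul2r (k0 (t i))) wk mul0n.
have ww (i j : 'I_d) : (j < i)%N -> (w j * (r i).+1 <= w i)%N.
  move=> ji; have ij : (t i < t j)%N.
    have d0 : (0 < d)%N by exact: leq_ltn_trans (ltn_ord i).
    by rewrite ltn_sub2l // -ltnS prednK // (leq_ltn_trans ji).
  apply: leq_trans (leq_divM (w i) (r i).+1); rewrite leq_mul2r -divnMA.
  (* By definition [k (t i).+1] is [k (t i) * (r i).+1], and it divides [k (t j)]. *)
  have kij := dvdn_leq (k0 (t j)) (dvdn_growth a b N ij).
  by rewrite leq_div2l ?orbT ?muln_gt0 ?k0.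
have wA i x : (0 < x)%N -> (w i * x <= m * k d.-1)%N ->
    A * (x%:R + s) `^ B < (r i).+1%:R.
  (* Cancelling [w i] leaves [x <= m * k (t i)], whence [x + s <= (m + s) * k (t i) <= N * k (t
     i)]. *)
  move=> x0; rewrite -(wk i) mulnCA leq_pmul2l // => xm.
  apply: (@le_lt_trans _ _ (r i)%:R); last by rewrite ltr_nat.
  apply: scaled_powR_le => //; first by rewrite ler_wpDr ?ler1n // ltW.
  rewrite natrM; apply: (@le_trans _ _ ((m%:R + s) * (k (t i))%:R)).
    by rewrite mulrDl -natrM lerD ?ler_nat // ler_peMr ?ler1n // ltW.
  by rewrite ler_wpM2r.
pose L0 := homogeneous_part (d := d) Q.
have gL0 : graded L0.
  by move=> i P; rewrite mem_filter => /andP[/andP[]].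
have szL0 : (\sum_(i < d) w i * size (L0 i) <= m * k d.-1)%N.
  apply: (@leq_trans (\sum_(i < d) k d.-1 * size (L0 i))).
    by apply: leq_sum => i _; rewrite leq_mul2r leq_div ?orbT.
  rewrite -big_distrr /= [leqRHS]mulnC leq_mul2l -(size_tuple Q).
  by rewrite sum_size_homogeneous_part orbT.
have [L [gL szL regL idL]] := regularize_layers w0 ww wA gL0 szL0.
have LP i P : P \in L i -> P != 0 /\ mdegree P = i.+1.
  by case/gL => P0 hP; split=> //; apply: mdegree_homogeneous.
exists (Tower LP); split=> //.
(* For [m = 0] and small [s] the bound [N <= 2 * (m + s)] fails, but then every layer is empty. *)
- have [m0|m0] := posnP m.
    suff -> : tower_dim (Tower LP) = 0%N by rewrite mulr_ge0 ?powR_ge0.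
    apply/eqP; rewrite /tower_dim /= -leqn0 -[leqRHS](mul0n (k d.-1)) -{2}m0.
    by apply: leq_trans szL; apply: leq_sum => i _; rewrite leq_pmull.
  have N2 : N%:R <= 2 * (m%:R + s).
    rewrite /N -addn1 natrD mulr_natl mulr2n lerD //.
      by rewrite truncn_le addr_ge0 // ltW.
    by rewrite ler_wpDr ?ler1n // ltW.
  apply: (@le_trans _ _ (C%:R * N%:R ^+ D.+1)).
    rewrite -natrX -natrM ler_nat expnS mulnCA.
    apply: (@leq_trans (m * k d.-1)).
      by apply: leq_trans szL; apply: leq_sum => i _; rewrite leq_pmull.
    apply: leq_mul; last exact: growth_le.
    by rewrite -(ler_nat R) (le_trans _ msN) // lerDl ltW.
  have ms0 : 0 <= m%:R + s by rewrite addr_ge0 // ltW.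
  rewrite powR_mulrn // natrM -mulrA natrX -exprMn ler_wpM2l //.
  by apply: lerXn2r; rewrite ?nnegrE ?ler0n ?mulr_ge0.
- by apply/bigmax_leqP => i _; exact: ltn_ord.
(* Zero entries of [Q] were discarded by [homogeneous_part], but lie in every ideal. *)
- move=> P PQ; apply: idL; have [->|P0] := eqVneq P 0; first exact: in_ideal0.
  have [e [/andP[e0 ed] he]] := hQ P PQ.
  have ed' : (e.-1 < d)%N by rewrite prednK.
  apply/mem_in_ideal/all_layersP; exists (Ordinal ed').
  by rewrite mem_filter P0 /= prednK // he.
Qed.
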